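(* Let $(M,h)$ be a Riemannian spin surface, let $\Omega\subset M$ be a connected domain with local coordinates $x,y$ and coordinate vector fields $\partial_x,\partial_y$, let $\phi\colon\Omega\to S^n\subset\mathbb{R}^{n+1}$ be smooth, and let $\psi$ be a smooth section of $\Sigma M\otimes\phi^\ast TS^n$ over $\Omega$. For $\alpha\in\{x,y\}$ and $i,m\in\{1,\dots,n+1\}$ put $$J_\alpha^{im}:=\operatorname{Re}\langle \partial_\alpha\cdot\psi^i,\psi^m\rangle_{\Sigma M}+(\phi^i_\alpha\phi^m-\phi^i\phi^m_\alpha).$$ Then, with summation over $j$, $$\begin{aligned} \partial_x J_y^{im}&-\partial_y J_x^{im}-2(J^{ij}_x J^{jm}_y-J^{ij}_y J^{jm}_x) \\ =&-\operatorname{Re}\langle (\partial_x\cdot\nabla_{\partial_y}-\partial_y\cdot\nabla_{\partial_x})\psi^i,\psi^m\rangle_{\Sigma M} +\operatorname{Re}\langle\psi^i,(\partial_x\cdot\nabla_{\partial_y}-\partial_y\cdot\nabla_{\partial_x})\psi^m\rangle_{\Sigma M} \\ &-2\big(\operatorname{Re}\langle\psi^i,\partial_x\cdot\psi^j\rangle_{\Sigma M}\operatorname{Re}\langle\psi^j,\partial_y\cdot\psi^m\rangle_{\Sigma M} -\operatorname{Re}\langle\psi^i,\partial_y\cdot\psi^j\rangle_{\Sigma M}\operatorname{Re}\langle\psi^j,\partial_x\cdot\psi^m\rangle_{\Sigma M} \\ &\quad-\operatorname{Re}\langle\psi^i,\partial_x\cdot\psi^j\rangle_{\Sigma M}\phi^j_y\phi^m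 +\operatorname{Re}\langle\psi^j,\partial_y\cdot\psi^m\rangle_{\Sigma M}\phi^i\phi^j_x \\ &\quad+\operatorname{Re}\langle\psi^i,\partial_y\cdot\psi^j\rangle_{\Sigma M}\phi^j_x\phi^m -\operatorname{Re}\langle\psi^j,\partial_x\cdot\psi^m\rangle_{\Sigma M}\phi^i\phi^j_y\big). \end{aligned}$$
   Context: $\Sigma M$ is the spinor bundle of $(M,h)$ with hermitian scalar product $\langle\cdot,\cdot\rangle_{\Sigma M}$ and metric spin connection $\nabla$ (compatible with Clifford multiplication and the Levi-Civita connection). Clifford multiplication by tangent vectors is skew-symmetric, $\langle\psi,X\cdot\eta\rangle=-\langle X\cdot\psi,\eta\rangle$, and satisfies $X\cdot Y\cdot\psi+Y\cdot X\cdot\psi=-2h(X,Y)\psi$. A map to $S^n$ is written $\phi=(\phi^1,\dots,\phi^{n+1})$ with $|\phi|=1$; $\phi^j_x=\partial_x\phi^j$, $\phi^j_y=\partial_y\phi^j$. A section $\psi$ of $\Sigma M\otimes\phi^\ast TS^n$ is written $\psi=(\psi^1,\dots,\psi^{n+1})$ with each $\psi^i$ a section of $\Sigma M$ and $\sum_i\phi^i\psi^i=0$. *)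

(* Defs.v *)
From HB Require Import structures.
From mathcomp Require Import all_boot all_order all_algebra.
From mathcomp Require Import all_classical all_reals all_analysis.
From mathcomp Require Import complex ring.
Set Implicit Arguments.
Unset Strict Implicit.
Unset Printing Implicit Defensive.
Import Order.TTheory GRing.Theory Num.Theory.
Import numFieldNormedType.Exports.
Local Open Scope classical_set_scope.
Local Open Scope ring_scope.
Local Open Scope complex_scope.

Section Smooth.
Variable R : realType.

Definition basis_vec (k : 'I_2) : 'rV[R]_2 := delta_mx 0 k.

Definition partial (k : 'I_2) (f : 'rV[R]_2 -> R) : 'rV[R]_2 -> R :=
  fun u => 'D_(basis_vec k) f u.

Fixpoint Ck (n : nat) (U : set 'rV[R]_2) (f : 'rV[R]_2 -> R) : Prop :=
  if n is n'.+1 then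
    (forall u, U u -> differentiable f u) /\
    (forall k, Ck n' U (partial k f))
  else forall u, U u -> {for u, continuous f}.

(* Only meaningful, and only used, for U open. *)
Definition smooth_on (U : set 'rV[R]_2) (f : 'rV[R]_2 -> R) : Prop :=
  forall n, Ck n U f.

End Smooth.

Definition ix : 'I_2 := ord0.
Definition iy : 'I_2 := ord_max.

Section Charts.
Variables (R : realType) (M : topologicalType).

(* cmap and cinv are total functions, relevant on cdom and on its image. *)
Record chart := Chart {
  cdom : set M;
  cmap : M -> 'rV[R]_2;
  cinv : 'rV[R]_2 -> M }.

Definition cimg (c : chart) (U : set M) : set 'rV[R]_2 :=
  cmap c @` (U `&` cdom c).

Definition is_chart (c : chart) : Prop :=
  [/\ open (cdom c),
      open (cimg c setT),
      (forall p, cdom c p -> cinv c (cmap c p) = p),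
      (forall p, cdom c p -> {for p, continuous (cmap c)}) &
      (forall u, cimg c setT u -> {for u, continuous (cinv c)})].

Definition transition (c c' : chart) (k : 'I_2) : 'rV[R]_2 -> R :=
  fun u => cmap c' (cinv c u) 0 k.

Definition compatible (c c' : chart) : Prop :=
  forall k, smooth_on (cimg c (cdom c')) (transition c c' k) /\
            smooth_on (cimg c' (cdom c)) (transition c' c k).

(* Row convention: the i-th coordinate field of c has components
   (jac c c' p) i _ in the chart c'. *)
Definition jac (c c' : chart) (p : M) : 'M[R]_2 :=
  \matrix_(i, j) partial i (transition c c' j) (cmap c p).

(* Derivative of a function on M along the a-th coordinate field of c. *)
Definition pd (c : chart) (a : 'I_2) (f : M -> R) : M -> R :=
  fun p => partial a (f \o cinv c) (cmap c p).

Definition pdC (c : chart) (a : 'I_2) (f : M -> R[i]) : M -> R[i] :=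
  fun p => pd c a (fun q => complex.Re (f q)) p
           +i* pd c a (fun q => complex.Im (f q)) p.

End Charts.

Record smooth_surface (R : realType) := SmoothSurface {
  carrier :> topologicalType;
  surf_hausdorff : hausdorff_space carrier;
  surf_countable : @second_countable carrier;
  atlas : set (chart R carrier);
  atlas_chart : forall c, atlas c -> is_chart c;
  atlas_cover : forall p, exists2 c, atlas c & cdom c p;
  atlas_compatible : forall c c', atlas c -> atlas c' -> compatible c c';
  atlas_maximal : forall c, is_chart c ->
    (forall c', atlas c' -> compatible c c') -> atlas c }.

Section Geometry.
Variables (R : realType) (M : smooth_surface R).
Local Notation C := R[i].
Local Notation mchart := (chart R M).

Definition smooth (U : set M) (f : M -> R) : Prop :=
  forall c, atlas c -> smooth_on (cimg c U) (f \o cinv c).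

Definition smoothC (U : set M) (f : M -> C) : Prop :=
  smooth U (fun p => complex.Re (f p)) /\ smooth U (fun p => complex.Im (f p)).

(* gram c p is the matrix of h at p in the coordinate basis of c. *)
Record riemannian_metric := RiemannianMetric {
  gram : mchart -> M -> 'M[R]_2;
  gram_smooth : forall c, atlas c -> forall i j,
    smooth (cdom c) (fun p => gram c p i j);
  gram_sym : forall c, atlas c -> forall p, cdom c p ->
    (gram c p)^T = gram c p;
  gram_pos : forall c, atlas c -> forall p, cdom c p ->
    forall v : 'rV[R]_2, v != 0 -> 0 < (v *m gram c p *m v^T) 0 0;
  gram_change : forall c c', atlas c -> atlas c' ->
    forall p, cdom c p -> cdom c' p ->
    gram c p = jac c c' p *m gram c' p *m (jac c c' p)^T }.

(* A vector field given by its components in each chart. *)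
Definition vfield := mchart -> M -> 'rV[R]_2.

Definition is_vfield (U : set M) (X : vfield) : Prop :=
  (forall c, atlas c -> forall j,
     smooth (U `&` cdom c) (fun p => X c p 0 j)) /\
  (forall c c', atlas c -> atlas c' ->
     forall p, U p -> cdom c p -> cdom c' p -> X c' p = X c p *m jac c c' p).

Section Metric.
Variable h : riemannian_metric.

(* Inner product at p of two tangent vectors given in the chart c. *)
Definition inner (c : mchart) (p : M) (v w : 'rV[R]_2) : R :=
  (v *m gram h c p *m w^T) 0 0.

Definition christoffel (c : mchart) (m i j : 'I_2) (p : M) : R :=
  2^-1 * \sum_(l < 2) invmx (gram h c p) m l *
    (pd c i (fun q => gram h c q j l) p + pd c j (fun q => gram h c q i l) p
     - pd c l (fun q => gram h c q i j) p).

(* Levi-Civita derivative of Y along the i-th coordinate field of c,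
   in components with respect to c. *)
Definition levi_civita (c : mchart) (i : 'I_2) (Y : vfield) (p : M) :
    'rV[R]_2 :=
  \row_m (pd c i (fun q => Y c q 0 m) p
          + \sum_(j < 2) christoffel c m i j p * Y c p 0 j).

End Metric.

(* The irreducible complex representation of the Clifford algebra of the
   Euclidean plane, with the convention e_k e_l + e_l e_k = - 2 delta_kl. *)
Definition gamma (k : 'I_2) : 'M[C]_2 :=
  if k == ix then \matrix_(i, j) (if i == j then 0 else if i == ix then 1 else -1)
  else \matrix_(i, j) (if i == j then 0 else 'i).

Definition herm (u v : 'cV[C]_2) : C := \sum_(k < 2) u k 0 * (v k 0)^*.

(* An element a + b e_1 e_2 of Spin(2), with a ^ 2 + b ^ 2 = 1, is encoded as
   the unit complex number z = a + i b; the group laws agree.  spin_rep is the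
   spinor representation, and row k of spin_cover z lists the components of
   z e_k z^-1, the image of e_k under the double cover Spin(2) -> SO(2). *)
Definition spin_rep (z : C) : 'M[C]_2 :=
  ((complex.Re z)%:C)%:M + (complex.Im z)%:C *: (gamma ix *m gamma iy).

Definition spin_cover (z : C) : 'M[R]_2 :=
  \matrix_(k, l)
    if k == l then complex.Re (z ^+ 2)
    else if k == ix then complex.Im (z ^+ 2) else - complex.Im (z ^+ 2).

(* A spin structure given by a cover with orthonormal frames
   (e^a_1, e^a_2), any two of which differ by a rotation (so they orient M),
   and a Spin(2)-valued cocycle z_ab lifting the SO(2)-valued transition
   functions: e^b = e^a . spin_cover z_ab as frames. *)
Record spin_structure (h : riemannian_metric) := SpinStructure {
  spin_idx : Type;
  spin_dom : spin_idx -> set M;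
  spin_dom_open : forall a, open (spin_dom a);
  spin_cov : forall p, exists a, spin_dom a p;
  frame : spin_idx -> 'I_2 -> vfield;
  frame_vfield : forall a k, is_vfield (spin_dom a) (frame a k);
  frame_orthonormal : forall a k l c, atlas c ->
    forall p, spin_dom a p -> cdom c p ->
    inner h c p (frame a k c p) (frame a l c p) = (k == l)%:R;
  spin_lift : spin_idx -> spin_idx -> M -> C;
  spin_lift_smooth : forall a b,
    smoothC (spin_dom a `&` spin_dom b) (spin_lift a b);
  spin_lift_unit : forall a b p, spin_dom a p -> spin_dom b p ->
    `|spin_lift a b p| = 1;
  spin_lift_frame : forall a b k c, atlas c ->
    forall p, spin_dom a p -> spin_dom b p -> cdom c p ->
    frame b k c p =
      \sum_(l < 2) spin_cover (spin_lift a b p) k l *: frame a l c p;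
  spin_cocycle : forall a b d p,
    spin_dom a p -> spin_dom b p -> spin_dom d p ->
    spin_lift a b p * spin_lift b d p = spin_lift a d p }.

Section Spinors.
Variables (h : riemannian_metric) (s : spin_structure h).

(* Sections of the associated bundle Spin(M) x_rho C^2, given by their local
   representatives in the frames of the spin structure. *)
Definition spinor := spin_idx s -> M -> 'cV[C]_2.

Definition is_spinor_section (U : set M) (psi : spinor) : Prop :=
  (forall a k, smoothC (U `&` spin_dom a) (fun p => psi a p k 0)) /\
  (forall a b p, U p -> spin_dom a p -> spin_dom b p ->
     psi a p = spin_rep (spin_lift a b p) *m psi b p).

Definition spin_at (p : M) : spin_idx s := sval (cid (spin_cov s p)).

(* spin_rep is unitary, so the chosen frame is immaterial for sections. *)
Definition spinor_prod (psi eta : spinor) : M -> C :=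
  fun p => herm (psi (spin_at p) p) (eta (spin_at p) p).

Definition Re_prod (psi eta : spinor) : M -> R :=
  fun p => complex.Re (spinor_prod psi eta p).

(* Clifford product with the al-th coordinate field of c, expanded as
   sum_k h(d_al, e_k) e_k in the frame of each representative. *)
Definition clifford (c : mchart) (al : 'I_2) (psi : spinor) : spinor :=
  fun a p => \sum_(k < 2)
    (inner h c p (basis_vec R al) (frame a k c p))%:C *: (gamma k *m psi a p).

(* Spin connection along the al-th coordinate field of c:
   nabla psi = d psi + 1/4 sum_kl h(nabla e_k, e_l) e_k . e_l . psi. *)
Definition nabla (c : mchart) (al : 'I_2) (psi : spinor) : spinor :=
  fun a p =>
    (\col_k pdC c al (fun q => psi a q k 0) p)
    + (4^-1 : C) *: \sum_(k < 2) \sum_(l < 2)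
        (inner h c p (levi_civita h c al (frame a k) p)
                     (frame a l c p))%:C *:
        (gamma k *m gamma l *m psi a p).

Definition spinor_sub (psi eta : spinor) : spinor :=
  fun a p => psi a p - eta a p.

(* (d_x . nabla_{d_y} - d_y . nabla_{d_x}) psi *)
Definition twisted_D (c : mchart) (psi : spinor) : spinor :=
  spinor_sub (clifford c ix (nabla c iy psi)) (clifford c iy (nabla c ix psi)).

Definition sphere_map (n : nat) (U : set M) (phi : 'I_n.+1 -> M -> R) : Prop :=
  (forall i, smooth U (phi i)) /\
  (forall p, U p -> \sum_(i < n.+1) phi i p ^+ 2 = 1).

Definition section_along (n : nat) (U : set M) (phi : 'I_n.+1 -> M -> R)
    (psi : 'I_n.+1 -> spinor) : Prop :=
  (forall i, is_spinor_section U (psi i)) /\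
  (forall a p, U p -> spin_dom a p ->
     \sum_(i < n.+1) (phi i p)%:C *: psi i a p = 0).

Definition current (n : nat) (c : mchart) (phi : 'I_n.+1 -> M -> R)
    (psi : 'I_n.+1 -> spinor) (al : 'I_2) (i m : 'I_n.+1) : M -> R :=
  fun p => Re_prod (clifford c al (psi i)) (psi m) p
           + (pd c al (phi i) p * phi m p - phi i p * pd c al (phi m) p).

End Spinors.

Lemma gamma_clifford (k l : 'I_2) :
  gamma k *m gamma l + gamma l *m gamma k = (- 2 * (k == l)%:R)%:M.
Proof.
apply/matrixP => i j; rewrite !mxE !big_ord_recl !big_ord0 /gamma.
by case: k => [[|[|k]]] hk //; case: l => [[|[|l]]] hl //;
  case: i => [[|[|i]]] hi //; case: j => [[|[|j]]] hj //;
  rewrite !mxE /=; apply/eqP; rewrite eq_complex /=; apply/andP; split;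
  apply/eqP; ring.
Qed.

Lemma herm_gamma (k : 'I_2) (u v : 'cV[C]_2) :
  herm u (gamma k *m v) = - herm (gamma k *m u) v.
Proof.
rewrite /herm !big_ord_recl !big_ord0 !mxE !big_ord_recl !big_ord0 /gamma.
case: k => [[|[|k]]] hk //; rewrite !mxE /=;
  case: (u ord0 0) => ? ?; case: (v ord0 0) => ? ?;
  case: (u (lift _ _) 0) => ? ?; case: (v (lift _ _) 0) => ? ?;
  apply/eqP; rewrite eq_complex /=; apply/andP; split; apply/eqP; ring.
Qed.

Lemma spin_rep_cover (z : C) (k : 'I_2) :
  spin_rep z *m gamma k *m spin_rep z^* =
  \sum_(l < 2) (spin_cover z k l)%:C *: gamma l.
Proof.
apply/matrixP => i j.
rewrite !big_ord_recl !big_ord0 !mxE !big_ord_recl !big_ord0 !mxE.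
rewrite !big_ord_recl !big_ord0 !mxE.
rewrite !big_ord_recl !big_ord0 /gamma.
case: z => a b.
by case: k => [[|[|k]]] hk //; case: i => [[|[|i]]] hi //;
  case: j => [[|[|j]]] hj //; rewrite !mxE /=;
  apply/eqP; rewrite eq_complex /=; apply/andP; split; apply/eqP; ring.
Qed.

End Geometry.

(* Main.v *)
(** Differentiating the spinorial part of J in a local orthonormal frame produces
    the connection forms of the frame. Metric compatibility makes these
    antisymmetric, torsion-freeness makes the curl of the coframe components equal
    to the connection forms applied to the coframe, and both effects cancel
    against the connection term of the spin connection; what remains is the
    twisted Dirac expression. The second derivatives of phi cancel by Schwarz's
    theorem. In the quadratic term, |phi| = 1 and the tangency of psi kill every
    product containing an undifferentiated factor phi^j. *)

Require Import Defs.
From HB Require Import structures.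
From mathcomp Require Import all_boot all_order all_algebra.
From mathcomp Require Import all_classical all_reals all_analysis.
From mathcomp Require Import complex ring lra.
Set Implicit Arguments.
Unset Strict Implicit.
Unset Printing Implicit Defensive.
Import Order.TTheory GRing.Theory Num.Theory.
Import numFieldNormedType.Exports.
Local Open Scope classical_set_scope.
Local Open Scope ring_scope.

(** * Symmetry of mixed directional derivatives *)

Section MixedDerivatives.
Variables (R : realType) (V : normedModType R).
Implicit Types (f : V -> R) (x u v w : V).

Lemma is_derive_line f x v (t : R) : derivable f (x + t *: v) v ->
  is_derive t 1 (fun r : R => f (x + r *: v)) ('D_v f (x + t *: v)).
Proof.
have E : (fun h : R => h^-1 *:
      (((fun r : R => f (x + r *: v)) \o shift t) (h *: 1) - f (x + t *: v)))
    = (fun h : R => h^-1 *: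
      ((f \o shift (x + t *: v)) (h *: v) - f (x + t *: v))).
  apply/funext => r /=; congr (_ *: (f _ - _)).
  by rewrite -[r *: 1]/(r * 1) mulr1 scalerDl addrCA.
by move=> d; apply: DeriveDef; rewrite /derivable /derive E.
Qed.

Lemma MVT_line f x v (t : R) : 0 < t ->
  (forall r, 0 <= r <= t -> derivable f (x + r *: v) v) ->
  exists2 r, 0 <= r <= t & f (x + t *: v) - f x = 'D_v f (x + r *: v) * t.
Proof.
move=> t0 df.
have dl r : 0 <= r <= t -> _ := fun rt => is_derive_line (df r rt).
have [||r] := @MVT_segment R (fun r => f (x + r *: v))
    (fun r => 'D_v f (x + r *: v)) 0 t (ltW t0).
- by move=> r; rewrite in_itv /= => /andP[r0 rt]; apply: dl; rewrite !ltW.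
- apply: derivable_within_continuous => r; rewrite in_itv /= => rt.
  by have [] := dl r rt.
by rewrite in_itv/= scale0r addr0 subr0 => rt E; exists r.
Qed.

Lemma near_box (P : V -> Prop) u v w : (\forall x \near u, P x) ->
  exists2 t : R, 0 < t &
    forall r q, 0 <= r <= t -> 0 <= q <= t -> P (u + r *: v + q *: w).
Proof.
move=> /nbhs_ballP[e /= e0 eP].
have N0 : 0 < `|v| + `|w| + 1 by have := normr_ge0 v; have := normr_ge0 w; lra.
(* The [+ 1] keeps the denominator positive when [v] and [w] both vanish and makes the final bound
   strict. *)
exists (e / (`|v| + `|w| + 1)); first exact: divr_gt0.
move=> r q /andP[r0 rt] /andP[q0 qt]; apply: eP.
rewrite -ball_normE /ball_/= -addrA opprD addrA subrr add0r normrN.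
apply: le_lt_trans (ler_normD _ _) _; rewrite !normrZ !ger0_norm//.
apply: (@le_lt_trans _ _ (e / (`|v| + `|w| + 1) * (`|v| + `|w|))).
  by rewrite mulrDr lerD// ler_wpM2r.
by rewrite -mulrA -[ltRHS]mulr1 ltr_pM2l// mulrC ltr_pdivrMr//; lra.
Qed.

(** Two mean value steps: along [v] for the increment of [f] under translation by [t *: w], then
    along [w] for ['D_v f]. *)
Lemma second_difference f u v w (t : R) : 0 < t ->
  (forall r q, 0 <= r <= t -> 0 <= q <= t ->
     derivable f (u + r *: v + q *: w) v /\
     derivable ('D_v f) (u + r *: v + q *: w) w) ->
  exists r q, [/\ 0 <= r <= t, 0 <= q <= t &
    f (u + t *: v + t *: w) - f (u + t *: v) - (f (u + t *: w) - f u) =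
    'D_w ('D_v f) (u + r *: v + q *: w) * t * t].
Proof.
move=> t0 df.
have tt : 0 <= t <= t by rewrite lexx ltW.
have t00 : 0 <= (0 : R) <= t by rewrite lexx ltW.
pose g x := f (x + t *: w) - f x.
have dg r : 0 <= r <= t -> is_derive (u + r *: v) v g
    ('D_v f (u + r *: v + t *: w) - 'D_v f (u + r *: v)).
  move=> rt; apply: is_deriveB; last first.
    apply: derivableP; have [+ _] := df r 0 rt t00.
    by rewrite scale0r addr0.
  have [+ _] := df r t rt tt => d.
  have E : (fun h : R => h^-1 *:
        (((fun x => f (x + t *: w)) \o shift (u + r *: v)) (h *: v)
         - f (u + r *: v + t *: w)))
      = (fun h : R => h^-1 *:
        ((f \o shift (u + r *: v + t *: w)) (h *: v)
         - f (u + r *: v + t *: w))).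
    by apply/funext => h /=; rewrite -addrA.
  by apply: DeriveDef; rewrite /derivable /derive E.
have [r rt Er] : exists2 r, 0 <= r <= t &
    g (u + t *: v) - g u = 'D_v g (u + r *: v) * t.
  by apply: MVT_line => // r rt; have [] := dg r rt.
have [q qt Eq] : exists2 q, 0 <= q <= t &
    'D_v f (u + r *: v + t *: w) - 'D_v f (u + r *: v)
    = 'D_w ('D_v f) (u + r *: v + q *: w) * t.
  by apply: MVT_line => // q qt; have [] := df r q rt qt.
exists r, q; split=> //.
by rewrite -Eq -(derive_val (is_derive := dg r rt)) -Er.
Qed.

(** The second difference over a parallelogram is symmetric in its two edges. Hence in every small
    parallelogram at [u] each mixed derivative takes, at some point, the same value; continuity at
    [u] forces equality there. *)
Lemma derive_comm f u v w :
  (\forall x \near u, [/\ derivable f x v, derivable f x w,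
     derivable ('D_v f) x w & derivable ('D_w f) x v]) ->
  {for u, continuous ('D_w ('D_v f))} -> {for u, continuous ('D_v ('D_w f))} ->
  'D_w ('D_v f) u = 'D_v ('D_w f) u.
Proof.
move=> df cvw cwv; apply/eqP; rewrite -subr_eq0 -normr_le0.
apply/ler_addgt0Pr => e e0; rewrite add0r.
have e20 : 0 < e / 2 by rewrite divr_gt0.
have {}cvw : \forall x \near u, `|'D_w ('D_v f) u - 'D_w ('D_v f) x| < e / 2.
  by have /cvgrPdist_lt := cvw; apply.
have {}cwv : \forall x \near u, `|'D_v ('D_w f) u - 'D_v ('D_w f) x| < e / 2.
  by have /cvgrPdist_lt := cwv; apply.
have [t t0 H] := near_box v w (filterI df (filterI cvw cwv)).
have [|r [q [rt qt E]]] := @second_difference f u v w t t0.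
  by move=> r q rt qt; have [[]] := H r q rt qt.
have [|r' [q' [rt' qt' E']]] := @second_difference f u w v t t0.
  move=> r' q' rt' qt'; rewrite addrAC; have [[_ d1 _ d2] _] := H q' r' qt' rt'.
  by split.
have [_ [+ _]] := H r q rt qt; have [_ [_ +]] := H q' r' qt' rt'.
rewrite [u + q' *: v + _]addrAC.
(* Multiplied by [t * t], both sides are the same second difference. *)
have -> : 'D_w ('D_v f) (u + r *: v + q *: w) =
    'D_v ('D_w f) (u + r' *: w + q' *: v).
  apply: (mulIf (lt0r_neq0 t0)); apply: (mulIf (lt0r_neq0 t0)).
  apply: etrans (esym E) (etrans _ E'); rewrite [u + t *: w + _]addrAC.
  by rewrite !opprB addrACA [RHS]addrACA; congr (_ + _); exact: addrC.
move: ('D_v _ _) ('D_w _ u) ('D_v _ u) => x y z {H E E' cvw cwv df}.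
rewrite distrC => zx yx; rewrite -(subrKA x) (splitr e) ltW//.
by rewrite (le_lt_trans (ler_normD _ _))// ltrD.
Qed.

End MixedDerivatives.

(** * Derivatives in a chart *)

Section ChartDerivatives.
Variables (R : realType) (M : topologicalType) (c : chart R M).
Hypothesis chart_c : is_chart c.
Variable p : M.
Hypothesis cp : cdom c p.
Implicit Types (f g : M -> R) (a : 'I_2) (d e : R).

(** Unlike [pd], whose value is arbitrary where the derivative fails to exist, this relation carries
    differentiability, so the calculus rules compose without side conditions. *)
Definition is_pd a f d :=
  is_derive (cmap c p) (basis_vec R a) (f \o cinv c) d.

Lemma is_pdE a f d : is_pd a f d -> pd c a f p = d.
Proof. by case. Qed.

Lemma is_pd_eq a f d e : is_pd a f d -> d = e -> is_pd a f e.
Proof. by move=> ? <-. Qed.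

(** [cmap c] and [cinv c] are total but mutually inverse only on the chart; openness of its image
    makes this enough for germs, hence for derivatives. *)
Lemma near_chart (U : set M) : open U -> U p ->
  \forall v \near cmap c p,
    [/\ cdom c (cinv c v), U (cinv c v) & cmap c (cinv c v) = v].
Proof.
case: chart_c => _ oi cK _ cvi oU Up.
have cimgp : cimg c setT (cmap c p) by exists p.
have nU : \forall v \near cmap c p, U (cinv c v).
  by apply: (cvi _ cimgp); rewrite cK//; exact: open_nbhs_nbhs.
have ni : \forall v \near cmap c p, cimg c setT v.
  exact: open_nbhs_nbhs.
apply: filterS2 nU ni => v Uv [q [_ cq] qv].
by rewrite -qv cK// in Uv *.
Qed.

Lemma is_pd_local (U : set M) a f g d : open U -> U p ->
  (forall q, cdom c q -> U q -> f q = g q) -> is_pd a f d -> is_pd a g d.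
Proof.
move=> oU Up fg; apply: near_eq_is_derive.
by apply: filterS (near_chart oU Up) => v [? ? _] /=; exact: fg.
Qed.

Lemma is_pd_cst a (k : R) : is_pd a (fun=> k) 0.
Proof. exact: is_derive_cst. Qed.

Lemma is_pdD a f g d e :
  is_pd a f d -> is_pd a g e -> is_pd a (fun q => f q + g q) (d + e).
Proof. exact: is_deriveD. Qed.

Lemma is_pdB a f g d e :
  is_pd a f d -> is_pd a g e -> is_pd a (fun q => f q - g q) (d - e).
Proof. exact: is_deriveB. Qed.

Lemma is_pdM a f g d e :
  is_pd a f d -> is_pd a g e ->
  is_pd a (fun q => f q * g q) (d * g p + f p * e).
Proof.
case: chart_c => _ _ cK _ _ df dg; apply: (is_derive_eq (is_deriveM df dg)).
by rewrite /= cK// addrC [d * _]mulrC.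
Qed.

Lemma is_pd_sum n a (f : 'I_n -> M -> R) (d : 'I_n -> R) :
  (forall i, is_pd a (f i) (d i)) ->
  is_pd a (fun q => \sum_(i < n) f i q) (\sum_(i < n) d i).
Proof.
move=> df; have := is_derive_sum df; congr is_derive.
by apply/funext => v; rewrite fct_sumE.
Qed.

End ChartDerivatives.

Section SurfaceDerivatives.
Variables (R : realType) (M : smooth_surface R) (c : chart R M).
Hypothesis hc : atlas c.
Variable p : M.
Hypothesis cp : cdom c p.
Implicit Types (f g : M -> R) (a b : 'I_2).

Lemma smooth_is_pd (U : set M) a f : smooth U f -> U p ->
  is_pd c p a f (pd c a f p).
Proof.
move=> sf Up; have [df _] := sf c hc 1%N.
by apply/derivableP/diff_derivable/df; exists p.
Qed.

(** The inner derivative is read at [cmap c (cinv c v)], which is [v] only near [cmap c p], so the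
    two functions being differentiated agree as germs. *)
Lemma pd_pd a b f : pd c a (pd c b f) p =
  partial a (partial b (f \o cinv c)) (cmap c p).
Proof.
apply: near_eq_derive.
apply: filterS (near_chart (atlas_chart hc) cp openT I) => v [_ _ vE] /=.
by rewrite /pd vE.
Qed.

Lemma smooth_is_pd_pd a b f : smooth (cdom c) f ->
  is_pd c p a (pd c b f) (pd c a (pd c b f) p).
Proof.
move=> sf; have [_ /(_ b)[df _]] := sf c hc 2%N.
have d : is_derive (cmap c p) (basis_vec R a) (partial b (f \o cinv c))
    (partial a (partial b (f \o cinv c)) (cmap c p)).
  by apply/derivableP/diff_derivable/df; exists p.
rewrite pd_pd; apply: near_eq_is_derive d.
apply: filterS (near_chart (atlas_chart hc) cp openT I) => v [_ _ vE] /=.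
by rewrite /pd vE.
Qed.

Lemma pd_comm a b f : smooth (cdom c) f ->
  pd c a (pd c b f) p = pd c b (pd c a f) p.
Proof.
move=> sf; rewrite !pd_pd; apply: derive_comm.
- have [d0 H] := sf c hc 2%N; have [da _] := H a; have [db _] := H b.
  apply: filterS (near_chart (atlas_chart hc) cp openT I) => v [cv _ vE].
  have cimgv : cimg c (cdom c) v by exists (cinv c v).
  by split; apply: diff_derivable; [exact: d0|exact: d0|exact: db|exact: da].
- have [_ /(_ b)[_ /(_ a) H]] := sf c hc 2%N; by apply: H; exists p.
- have [_ /(_ a)[_ /(_ b) H]] := sf c hc 2%N; by apply: H; exists p.
Qed.

End SurfaceDerivatives.

(** * Clifford algebra in dimension two *)

Section SpinorAlgebra.
Variable R : realType.
Local Notation C := R[i].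
Local Notation Re := (@complex.Re R).
Local Notation Im := (@complex.Im R).
Implicit Types (u v : 'cV[C]_2) (z : C) (k l : 'I_2).

Lemma sum_ix_iy (V : zmodType) (F : 'I_2 -> V) : \sum_(k < 2) F k = F ix + F iy.
Proof.
rewrite big_ord_recl big_ord_recl big_ord0 addr0; congr (_ + F _).
exact: val_inj.
Qed.

Lemma forall_ix_iy (P : 'I_2 -> Prop) : P ix -> P iy -> forall k, P k.
Proof.
move=> Px Py k; have [->//|->//] : k = ix \/ k = iy.
by case: k => [[|[|k]] hk] //; [left|right]; exact: val_inj.
Qed.

(** Its expansion in real and imaginary parts reduces the spinor computations to polynomial
    identities over [R]. *)
Definition cliff_form k u v : R := Re (herm (gamma R k *m u) v).

Lemma cliff_form_ix u v : cliff_form ix u v =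
  Re (u iy 0) * Re (v ix 0) + Im (u iy 0) * Im (v ix 0)
  - Re (u ix 0) * Re (v iy 0) - Im (u ix 0) * Im (v iy 0).
Proof.
rewrite /cliff_form /herm sum_ix_iy !mxE !sum_ix_iy /gamma !mxE /=.
case: (u ix 0) => ? ?; case: (u iy 0) => ? ?.
by case: (v ix 0) => ? ?; case: (v iy 0) => ? ? /=; ring.
Qed.

Lemma cliff_form_iy u v : cliff_form iy u v =
  Re (u iy 0) * Im (v ix 0) - Im (u iy 0) * Re (v ix 0)
  + Re (u ix 0) * Im (v iy 0) - Im (u ix 0) * Re (v iy 0).
Proof.
rewrite /cliff_form /herm sum_ix_iy !mxE !sum_ix_iy /gamma !mxE /=.
case: (u ix 0) => ? ?; case: (u iy 0) => ? ?.
by case: (v ix 0) => ? ?; case: (v iy 0) => ? ? /=; ring.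
Qed.

Definition cliff_formE := (cliff_form_ix, cliff_form_iy).

(** The product of the two gamma matrices is diagonal with entries ['i] and [- 'i], so Spin(2) acts
    on the two half-spinor components by [z] and its conjugate. *)
Lemma spin_repE z u k :
  (spin_rep z *m u) k 0 = (if k == ix then z else z^*) * u k 0.
Proof.
rewrite mxE sum_ix_iy /spin_rep !mxE !sum_ix_iy /gamma !mxE.
move: k; apply: forall_ix_iy; case: z => x y;
 case: (u ix 0) => ? ?; case: (u iy 0) => ? ? /=;
 apply/eqP; rewrite eq_complex /=; apply/andP; split; apply/eqP; ring.
Qed.

(** [spin_rep z] is unitary for unit [z], and conjugation by it rotates the gamma matrices through
    the double cover. The polynomial identity holds for every [z]. *)
Lemma cliff_form_spin_rep z l u v :
  cliff_form l (spin_rep z *m u) (spin_rep z *m v) =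
  \sum_(k < 2) spin_cover z k l * cliff_form k u v.
Proof.
rewrite sum_ix_iy; move: l; apply: forall_ix_iy;
rewrite !cliff_formE !spin_repE /spin_cover !mxE /=; case: z => x y;
case: (u ix 0) => ? ?; case: (u iy 0) => ? ?;
case: (v ix 0) => ? ?; case: (v iy 0) => ? ? /=; ring.
Qed.

Lemma Re_herm_cliff (W : 'I_2 -> R) u v :
  Re (herm (\sum_(k < 2) (W k)%:C%C *: (gamma R k *m u)) v) =
  \sum_(k < 2) W k * cliff_form k u v.
Proof.
rewrite !sum_ix_iy !cliff_formE /herm sum_ix_iy !mxE !sum_ix_iy /gamma !mxE /=.
case: (u ix 0) => ? ?; case: (u iy 0) => ? ?.
by case: (v ix 0) => ? ?; case: (v iy 0) => ? ? /=; ring.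
Qed.

Lemma Re_herm_cliff_r (W : 'I_2 -> R) u v :
  Re (herm u (\sum_(k < 2) (W k)%:C%C *: (gamma R k *m v))) =
  - \sum_(k < 2) W k * cliff_form k u v.
Proof.
rewrite !sum_ix_iy !cliff_formE /herm sum_ix_iy !mxE !sum_ix_iy /gamma !mxE /=.
case: (u ix 0) => ? ?; case: (u iy 0) => ? ?.
by case: (v ix 0) => ? ?; case: (v iy 0) => ? ? /=; ring.
Qed.

Lemma herm_subl u u' v : herm (u - u') v = herm u v - herm u' v.
Proof. by rewrite /herm !sum_ix_iy !mxE; ring. Qed.

Lemma herm_subr u v v' : herm u (v - v') = herm u v - herm u v'.
Proof. by rewrite /herm !sum_ix_iy !mxE !rmorphB; ring. Qed.

Lemma herm_suml n (u : 'I_n -> 'cV[C]_2) v :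
  herm (\sum_j u j) v = \sum_j herm (u j) v.
Proof.
rewrite /herm exchange_big /=; apply: eq_bigr => k _.
by rewrite summxE mulr_suml.
Qed.

Lemma Re_hermC u v : Re (herm u v) = Re (herm v u).
Proof.
rewrite /herm !sum_ix_iy.
case: (u ix 0) => ? ?; case: (u iy 0) => ? ?.
by case: (v ix 0) => ? ?; case: (v iy 0) => ? ? /=; ring.
Qed.

Definition spin_conn (w : 'I_2 -> 'I_2 -> R) (u : 'cV[C]_2) : 'cV[C]_2 :=
  4^-1 *: \sum_(k < 2) \sum_(l < 2) (w k l)%:C%C *: (gamma R k *m gamma R l *m u).

(** Antisymmetry leaves two off-diagonal terms, equal because the gamma matrices anticommute; this
    turns the factor 1/4 into 1/2, and the remaining gamma product is diagonal. *)
Lemma spin_connE (w : 'I_2 -> 'I_2 -> R) u k :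
  (forall k l, w k l + w l k = 0) ->
  spin_conn w u k 0 =
  (2^-1 * w ix iy * (if k == ix then 1 else -1))%:C%C * ('i%C * u k 0).
Proof.
move=> anti.
have w0 k' : w k' k' = 0 by have := anti k' k'; lra.
have wyx : w iy ix = - w ix iy by apply/eqP; rewrite -addr_eq0 anti.
have E4 : (4^-1 : C) = (4^-1 : R)%:C%C by rewrite fmorphV/= rmorph_nat.
have gg : gamma R iy *m gamma R ix = - (gamma R ix *m gamma R iy).
  apply/eqP; rewrite -addr_eq0 gamma_clifford /= mulr0; apply/eqP/matrixP => a b.
  by rewrite !mxE mul0rn.
have -> : spin_conn w u =
    (2^-1 * w ix iy)%:C%C *: (gamma R ix *m (gamma R iy *m u)).
  rewrite /spin_conn !sum_ix_iy !w0 wyx E4 gg mulNmx scalerN rmorphN !scaleNr.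
  rewrite opprK !scale0r add0r addr0 -scalerDl -rmorphD scalerA -rmorphM mulmxA.
  by congr (_%:C%C *: _); field.
rewrite mxE; move: (2^-1 * w ix iy) => r.
have -> : (gamma R ix *m (gamma R iy *m u)) k 0 =
    (if k == ix then 1 else -1) * ('i%C * u k 0).
  rewrite mxE sum_ix_iy !(mxE _ _ _ 0) !sum_ix_iy /gamma !mxE.
  by move: k; apply: forall_ix_iy => /=;
    rewrite !(mul0r, mul1r, mulr0, add0r, addr0).
by case: ifP => _; rewrite ?rmorphM/= ?rmorph1 ?rmorphN ?rmorph1; ring.
Qed.

(** The pointwise algebra of the cancellation. [V] and [W] stand for the frame components of the two
    coordinate fields, [wx] and [wy] for the connection forms. The spin connection term is
    skew-Hermitian and its commutator with a gamma matrix is the infinitesimal rotation of the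
    frame, which matches the curl terms on the left. *)
Lemma frame_curl_spin_conn (V W : 'I_2 -> R) (wx wy : 'I_2 -> 'I_2 -> R)
    (u v ux uy vx vy : 'cV[C]_2) :
  (forall k l, wx k l + wx l k = 0) -> (forall k l, wy k l + wy l k = 0) ->
  \sum_(k < 2) ((\sum_(l < 2) (wx k l * W l - wy k l * V l)) * cliff_form k u v
     + W k * (cliff_form k ux v + cliff_form k u vx)
     - V k * (cliff_form k uy v + cliff_form k u vy))
  = \sum_(k < 2) (W k * cliff_form k (ux + spin_conn wx u) v
                  - V k * cliff_form k (uy + spin_conn wy u) v)
  + \sum_(k < 2) (W k * cliff_form k u (vx + spin_conn wx v)
                  - V k * cliff_form k u (vy + spin_conn wy v)).
Proof.
move=> ax ay.
have addcE (a b : 'cV[C]_2) k : (a + b) k 0 = a k 0 + b k 0 by rewrite mxE.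
have w0 (w : 'I_2 -> 'I_2 -> R) : (forall k l, w k l + w l k = 0) ->
    [/\ w ix ix = 0, w iy iy = 0 & w iy ix = - w ix iy].
  move=> aw; split; [have := aw ix ix|have := aw iy iy|have := aw iy ix]; lra.
have [x0 x1 x2] := w0 _ ax; have [y0 y1 y2] := w0 _ ay.
(* Only the componentwise formulas for the connection terms are kept; what remains is polynomial in
   real and imaginary parts. *)
move: (fun k => spin_connE u k ax) (fun k => spin_connE u k ay)
  (fun k => spin_connE v k ax) (fun k => spin_connE v k ay).
move: (spin_conn wx u) (spin_conn wy u) (spin_conn wx v) (spin_conn wy v).
move=> Ux Uy Vx Vy EUx EUy EVx EVy.
rewrite !sum_ix_iy x0 x1 x2 y0 y1 y2.
rewrite !cliff_form_ix !cliff_form_iy !addcE !EUx !EUy !EVx !EVy /=.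
move: (u ix 0) (u iy 0) (v ix 0) (v iy 0) => [? ?] [? ?] [? ?] [? ?] /=.
rewrite -/ix; move: (wx ix iy) (wy ix iy) (V ix) (V iy) (W ix) (W iy).
move: (ux ix 0) (ux iy 0) (vx ix 0) (vx iy 0) => [? ?] [? ?] [? ?] [? ?] /=.
move: (uy ix 0) (uy iy 0) (vy ix 0) (vy iy 0) => [? ?] [? ?] [? ?] [? ?] /=.
by move=> *; field.
Qed.
End SpinorAlgebra.

(** * The Levi-Civita connection *)

Section LeviCivita.
Variables (R : realType) (M : smooth_surface R) (h : riemannian_metric M).
Variables (c : chart R M) (hc : atlas c).
Implicit Types (v w : 'rV[R]_2) (X Y : vfield M) (i j k l a : 'I_2).

Lemma innerE q v w : inner h c q v w =
  \sum_(i < 2) \sum_(j < 2) v 0 i * gram h c q i j * w 0 j.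
Proof.
rewrite /inner mxE !sum_ix_iy !mxE !sum_ix_iy.
by ring.
Qed.

Variable p : M.
Hypothesis cp : cdom c p.

Local Notation dgram a i j := (pd c a (fun q => gram h c q i j) p).

Lemma gramC q i j : cdom c q -> gram h c q i j = gram h c q j i.
Proof. by move=> cq; rewrite -{1}(gram_sym h hc cq) mxE. Qed.

Lemma gram_is_pd a i j : is_pd c p a (fun q => gram h c q i j) (dgram a i j).
Proof. exact: (smooth_is_pd hc cp a (@gram_smooth R M h c hc i j) cp). Qed.

Lemma dgramC a i j : dgram a i j = dgram a j i.
Proof.
apply: is_pdE.
apply: (is_pd_local (atlas_chart hc) cp openT I _ (gram_is_pd a j i)) => q cq _.
exact: gramC.
Qed.

Lemma gram_unit : gram h c p \in unitmx.
Proof.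
rewrite -row_free_unit -kermx_eq0; apply/rowV0P => v /sub_kermxP vg.
apply/eqP; apply: contraT => v0.
by have := gram_pos h hc cp v0; rewrite vg mul0mx mxE ltxx.
Qed.

Lemma innerC v w : inner h c p v w = inner h c p w v.
Proof. by rewrite !innerE !sum_ix_iy (gramC iy ix cp); ring. Qed.

(** Lowering the index cancels the inverse Gram matrix and leaves the Christoffel symbols of the
    first kind, so later computations are free of inverses. *)
Lemma christoffel_lower i j l :
  \sum_(m < 2) christoffel h c m i j p * gram h c p m l =
  2^-1 * (dgram i j l + dgram j i l - dgram l i j).
Proof.
pose B l' := dgram i j l' + dgram j i l' - dgram l' i j.
transitivity (2^-1 * \sum_(l' < 2) (gram h c p *m invmx (gram h c p)) l l' * B l').
  rewrite !sum_ix_iy /christoffel !sum_ix_iy !mxE !sum_ix_iy.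
  by rewrite (gramC ix l cp) (gramC iy l cp) /B; ring.
rewrite mulmxV ?gram_unit// !sum_ix_iy !mxE -/(B l).
by congr (_ * _); move: l; apply: forall_ix_iy => /=;
  rewrite mul1r mul0r ?addr0 ?add0r.
Qed.

Lemma christoffelC m i j : christoffel h c m i j p = christoffel h c m j i p.
Proof.
congr (_ * _); apply: eq_bigr => l _; congr (_ * _).
by rewrite (dgramC l i j) [dgram i j l + _]addrC.
Qed.

Lemma inner_levi_civita a X w : inner h c p (levi_civita h c a X p) w =
  \sum_(i < 2) \sum_(j < 2) (pd c a (fun q => X c q 0 i) p * gram h c p i j
    + X c p 0 i * (2^-1 * (dgram a i j + dgram i a j - dgram j a i))) * w 0 j.
Proof.
rewrite innerE !sum_ix_iy -!christoffel_lower !sum_ix_iy /levi_civita !mxE.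
by rewrite !sum_ix_iy; ring.
Qed.

(** Metric compatibility: the two first-kind Christoffel terms add up to the derivative of the Gram
    matrix. *)
Lemma inner_is_pd a X Y :
  (forall j, is_pd c p a (fun q => X c q 0 j) (pd c a (fun q => X c q 0 j) p)) ->
  (forall j, is_pd c p a (fun q => Y c q 0 j) (pd c a (fun q => Y c q 0 j) p)) ->
  is_pd c p a (fun q => inner h c q (X c q) (Y c q))
    (inner h c p (levi_civita h c a X p) (Y c p)
     + inner h c p (X c p) (levi_civita h c a Y p)).
Proof.
have ch := atlas_chart hc.
move=> dX dY; rewrite (_ : (fun q => _) = (fun q => \sum_(i < 2) \sum_(j < 2)
    X c q 0 i * gram h c q i j * Y c q 0 j)); last first.
  by apply/funext => q; rewrite innerE.
apply: is_pd_eq.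
  apply: is_pd_sum => i; apply: is_pd_sum => j.
  exact: is_pdM (is_pdM _ _ (dX i) (gram_is_pd a i j)) (dY j).
rewrite [X in _ = _ + X]innerC !inner_levi_civita !sum_ix_iy.
rewrite (gramC iy ix cp) (dgramC a iy ix).
by field.
Qed.

(** Torsion-freeness for commuting coordinate fields: their components are constant, so only the
    symmetric Christoffel symbols remain. *)
Lemma levi_civita_basisC a b :
  levi_civita h c a (fun _ _ => basis_vec R b) p =
  levi_civita h c b (fun _ _ => basis_vec R a) p.
Proof.
apply/rowP => m; rewrite !mxE !(is_pdE (is_pd_cst _ _ _ _)) !add0r.
rewrite !sum_ix_iy !mxE; move: a b.
apply: forall_ix_iy; apply: forall_ix_iy => //=;
  by rewrite !(mulr0, mulr1, add0r, addr0) christoffelC.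
Qed.

Lemma inner_orthonormal (e : 'I_2 -> 'rV[R]_2) v w :
  (forall k l, inner h c p (e k) (e l) = (k == l)%:R) ->
  inner h c p v w = \sum_(l < 2) inner h c p v (e l) * inner h c p w (e l).
Proof.
move=> on; pose E : 'M[R]_2 := \matrix_k e k.
have EgE : (E *m gram h c p) *m E^T = 1%:M.
  apply/matrixP => k l; rewrite [RHS]mxE -on innerE mxE !sum_ix_iy.
  by rewrite !mxE !sum_ix_iy !mxE; ring.
(* For square matrices orthonormality gives completeness of the frame, which is then inserted before
   [w^T]. *)
have EE := mulmx1C EgE.
rewrite {1}/inner -[w^T]mul1mx -EE !mulmxA -mulmxA -mulmxA mxE.
apply: eq_bigr => l _; rewrite (innerC w) !innerE !mxE !sum_ix_iy !mxE !sum_ix_iy.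
by rewrite !mxE; congr (_ * _); ring.
Qed.

End LeviCivita.

(** * The spin connection in an orthonormal frame *)

Section SpinFrames.
Variables (R : realType) (M : smooth_surface R) (h : riemannian_metric M).
Variables (s : spin_structure h) (c : chart R M) (hc : atlas c).
Local Notation C := R[i].
Implicit Types (a b : spin_idx s) (k l al be : 'I_2) (p q : M).

Definition coframe a al k q : R :=
  inner h c q (basis_vec R al) (frame a k c q).

(** The connection one-forms of the frame, evaluated on a coordinate field; they are the
    coefficients in [nabla]. *)
Definition conn_form a al p k l : R :=
  inner h c p (levi_civita h c al (frame a k) p) (frame a l c p).

Lemma frame_is_pd a k al j p : cdom c p -> spin_dom a p ->
  is_pd c p al (fun q => frame a k c q 0 j)
    (pd c al (fun q => frame a k c q 0 j) p).
Proof.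
move=> cp ap; have [fs _] := frame_vfield a k.
exact: (smooth_is_pd hc cp al (fs c hc j) (conj ap cp)).
Qed.

(** Differentiate the constant inner products of the orthonormal frame. *)
Lemma conn_form_anti a al p k l : cdom c p -> spin_dom a p ->
  conn_form a al p k l + conn_form a al p l k = 0.
Proof.
move=> cp ap.
rewrite /conn_form (innerC h hc cp (levi_civita h c al (frame a l) p)).
rewrite -(is_pdE (inner_is_pd h hc cp (fun j => frame_is_pd k al j cp ap)
  (fun j => frame_is_pd l al j cp ap))).
apply: is_pdE.
apply: (is_pd_local (atlas_chart hc) cp (spin_dom_open a) ap _
  (is_pd_cst c p al (k == l)%:R)) => q cq aq.
by rewrite frame_orthonormal.
Qed.

(** Metric compatibility splits the derivative in two. The first term is symmetric in [al] and [be]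
    and drops out of the curl; the second is expanded in the frame. *)
Lemma coframe_is_pd a al be k p : cdom c p -> spin_dom a p ->
  is_pd c p be (coframe a al k)
    (inner h c p (levi_civita h c be (fun _ _ => basis_vec R al) p) (frame a k c p)
     + \sum_(l < 2) conn_form a be p k l * coframe a al l p).
Proof.
move=> cp ap.
have d0 j : is_pd c p be (fun q => (fun _ _ => basis_vec R al : 'rV_2) c q 0 j)
    (pd c be (fun q => (fun _ _ => basis_vec R al : 'rV_2) c q 0 j) p).
  apply: is_pd_eq (is_pd_cst c p be _) _.
  by rewrite (is_pdE (is_pd_cst c p be _)).
apply: (is_pd_eq (inner_is_pd h hc cp (X := fun _ _ => basis_vec R al)
  d0 (fun j => frame_is_pd k be j cp ap))).
congr (_ + _).
rewrite (inner_orthonormal hc cp _ _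
  (fun k l => frame_orthonormal k l hc ap cp)).
by apply: eq_bigr => l _; rewrite mulrC.
Qed.

(* The two torsion terms cancel since the coordinate fields commute. *)
Lemma coframe_curl a k p : cdom c p -> spin_dom a p ->
  pd c ix (coframe a iy k) p - pd c iy (coframe a ix k) p =
  \sum_(l < 2) (conn_form a ix p k l * coframe a iy l p
                - conn_form a iy p k l * coframe a ix l p).
Proof.
move=> cp ap; rewrite !(is_pdE (coframe_is_pd _ _ k cp ap)).
by rewrite (levi_civita_basisC h hc cp ix iy) opprD addrACA subrr add0r sumrB.
Qed.

Lemma nablaE al (psi : spinor s) a p : nabla c al psi a p =
  (\col_k pdC c al (fun q => psi a q k 0) p)
  + spin_conn (conn_form a al p) (psi a p).
Proof. by []. Qed.

(** A Leibniz rule: the gamma matrices do not depend on the point, so only spinor components are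
    differentiated. *)
Lemma cliff_form_is_pd (U : set M) p al k (F G : M -> 'cV[C]_2) :
  cdom c p -> U p ->
  (forall j, smoothC U (fun q => F q j 0)) ->
  (forall j, smoothC U (fun q => G q j 0)) ->
  is_pd c p al (fun q => cliff_form k (F q) (G q))
    (cliff_form k (\col_j pdC c al (fun q => F q j 0) p) (G p)
     + cliff_form k (F p) (\col_j pdC c al (fun q => G q j 0) p)).
Proof.
move=> cp Up sF sG; have ch := atlas_chart hc.
have dRe H j : (forall j, smoothC U (fun q => (H q : 'cV[C]_2) j 0)) ->
    is_pd c p al (fun q => complex.Re (H q j 0)) _ :=
  fun sH => smooth_is_pd hc cp al (proj1 (sH j)) Up.
have dIm H j : (forall j, smoothC U (fun q => (H q : 'cV[C]_2) j 0)) ->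
    is_pd c p al (fun q => complex.Im (H q j 0)) _ :=
  fun sH => smooth_is_pd hc cp al (proj2 (sH j)) Up.
have RM i j := is_pdM ch cp (dRe F i sF) (dRe G j sG).
have IM i j := is_pdM ch cp (dIm F i sF) (dIm G j sG).
have RI i j := is_pdM ch cp (dRe F i sF) (dIm G j sG).
have IR i j := is_pdM ch cp (dIm F i sF) (dRe G j sG).
move: k; apply: forall_ix_iy.
- apply: (is_pd_local ch cp openT I
    (fun q _ _ => esym (cliff_form_ix (F q) (G q)))).
  apply: is_pd_eq.
    exact: is_pdB (is_pdB (is_pdD (RM iy ix) (IM iy ix)) (RM ix iy)) (IM ix iy).
  by rewrite !cliff_form_ix !mxE /pdC /=; ring.
- apply: (is_pd_local ch cp openT I
    (fun q _ _ => esym (cliff_form_iy (F q) (G q)))).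
  apply: is_pd_eq.
    exact: is_pdB (is_pdD (is_pdB (RI iy ix) (IR iy ix)) (RI ix iy)) (IR ix iy).
  by rewrite !cliff_form_iy !mxE /pdC /=; ring.
Qed.

Lemma spin_at_dom p : spin_dom (spin_at s p) p.
Proof. exact: (svalP (cid (spin_cov s p))). Qed.

Lemma coframe_change a b al k q : cdom c q -> spin_dom a q -> spin_dom b q ->
  coframe b al k q =
  \sum_(l < 2) spin_cover (spin_lift a b q) k l * coframe a al l q.
Proof.
move=> cq aq bq; rewrite /coframe (spin_lift_frame k hc aq bq cq).
by rewrite /inner !sum_ix_iy linearD !linearZ mulmxDr -!scalemxAr !mxE.
Qed.

Lemma Re_prod_clifford (psi eta : spinor s) al q :
  Re_prod (clifford c al psi) eta q =
  \sum_(k < 2) coframe (spin_at s q) al k q *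
    cliff_form k (psi (spin_at s q) q) (eta (spin_at s q) q).
Proof. exact: (Re_herm_cliff (fun k => coframe (spin_at s q) al k q)). Qed.

Lemma Re_prod_clifford_r (psi eta : spinor s) al q :
  Re_prod psi (clifford c al eta) q =
  - \sum_(k < 2) coframe (spin_at s q) al k q *
    cliff_form k (psi (spin_at s q) q) (eta (spin_at s q) q).
Proof. exact: (Re_herm_cliff_r (fun k => coframe (spin_at s q) al k q)). Qed.

Lemma Re_prod_cliffordC (psi eta : spinor s) al q :
  Re_prod (clifford c al psi) eta q = - Re_prod psi (clifford c al eta) q.
Proof. by rewrite Re_prod_clifford Re_prod_clifford_r opprK. Qed.

Lemma Re_prod_subl (psi psi' eta : spinor s) q :
  Re_prod (spinor_sub psi psi') eta q = Re_prod psi eta q - Re_prod psi' eta q.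
Proof. by rewrite /Re_prod /spinor_prod /spinor_sub herm_subl raddfB. Qed.

Lemma Re_prod_subr (psi eta eta' : spinor s) q :
  Re_prod psi (spinor_sub eta eta') q = Re_prod psi eta q - Re_prod psi eta' q.
Proof. by rewrite /Re_prod /spinor_prod /spinor_sub herm_subr raddfB. Qed.

(** The same [spin_cover] matrix relates the coframes and the Clifford forms of two frames, in
    opposite directions. This frees the product from the pointwise choice [spin_at]. *)
Lemma Re_prod_clifford_frame (U : set M) (psi eta : spinor s) a al q :
  is_spinor_section U psi -> is_spinor_section U eta ->
  U q -> cdom c q -> spin_dom a q ->
  Re_prod (clifford c al psi) eta q =
  \sum_(k < 2) coframe a al k q * cliff_form k (psi a q) (eta a q).
Proof.
move=> [_ spsi] [_ seta] Uq cq aq; have bq := spin_at_dom q.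
rewrite Re_prod_clifford (spsi _ _ _ Uq aq bq) (seta _ _ _ Uq aq bq).
move: (psi _ _) (eta _ _) => u v.
rewrite !sum_ix_iy !cliff_form_spin_rep !(coframe_change _ _ cq aq bq) !sum_ix_iy.
by ring.
Qed.

Lemma Re_prod_clifford_is_pd (U : set M) (psi eta : spinor s) al be p
    (a := spin_at s p)
    (D := fun psi : spinor s => \col_k pdC c be (fun q => psi a q k 0) p) :
  open U -> is_spinor_section U psi -> is_spinor_section U eta ->
  cdom c p -> U p ->
  is_pd c p be (Re_prod (clifford c al psi) eta)
   (\sum_(k < 2) (pd c be (coframe a al k) p * cliff_form k (psi a p) (eta a p)
      + coframe a al k p * (cliff_form k (D psi) (eta a p)
                            + cliff_form k (psi a p) (D eta)))).
Proof.
move=> oU spsi seta cp Up; have ap : spin_dom a p := spin_at_dom p.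
have ch := atlas_chart hc.
(* [spin_at] may jump from point to point, so the frame chosen at [p] is frozen on a neighbourhood
   before differentiating. *)
apply: (is_pd_local ch cp (openI oU (spin_dom_open a)) (conj Up ap)
  (f := fun q => \sum_(k < 2) coframe a al k q * cliff_form k (psi a q) (eta a q))).
  by move=> q cq [Uq aq]; rewrite (Re_prod_clifford_frame _ spsi seta Uq cq aq).
apply: is_pd_sum => k; apply: is_pdM => //.
  by rewrite (is_pdE (coframe_is_pd _ _ _ cp ap)); exact: coframe_is_pd.
apply: (cliff_form_is_pd (U := U `&` spin_dom a)) => //.
  by move=> j; have [] := spsi.
by move=> j; have [] := seta.
Qed.

Lemma Re_prod_cliffordB (X Y eta : spinor s) p (a := spin_at s p) :
  Re_prod (spinor_sub (clifford c ix X) (clifford c iy Y)) eta p =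
  \sum_(k < 2) (coframe a ix k p * cliff_form k (X a p) (eta a p)
                - coframe a iy k p * cliff_form k (Y a p) (eta a p)).
Proof. by rewrite Re_prod_subl !Re_prod_clifford -sumrB. Qed.

Lemma Re_prod_cliffordB_r (psi X Y : spinor s) p (a := spin_at s p) :
  Re_prod psi (spinor_sub (clifford c ix X) (clifford c iy Y)) p =
  \sum_(k < 2) (coframe a iy k p * cliff_form k (psi a p) (Y a p)
                - coframe a ix k p * cliff_form k (psi a p) (X a p)).
Proof. by rewrite Re_prod_subr !Re_prod_clifford_r opprK addrC -sumrB. Qed.

Lemma Re_prod_clifford_curl (psi eta : spinor s) p :
  is_spinor_section (cdom c) psi -> is_spinor_section (cdom c) eta ->
  cdom c p ->
  pd c ix (Re_prod (clifford c iy psi) eta) p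
    - pd c iy (Re_prod (clifford c ix psi) eta) p =
  - Re_prod (twisted_D c psi) eta p + Re_prod psi (twisted_D c eta) p.
Proof.
move=> spsi seta cp; have [oc _ _ _ _] := atlas_chart hc.
have ap := spin_at_dom p; set a := spin_at s p in ap *.
rewrite !(is_pdE (Re_prod_clifford_is_pd _ _ oc spsi seta cp cp)) -/a.
rewrite /twisted_D Re_prod_cliffordB Re_prod_cliffordB_r -/a !nablaE.
have := @frame_curl_spin_conn R (coframe a ix ^~ p) (coframe a iy ^~ p)
  (conn_form a ix p) (conn_form a iy p) (psi a p) (eta a p)
  (\col_k pdC c ix (fun q => psi a q k 0) p)
  (\col_k pdC c iy (fun q => psi a q k 0) p)
  (\col_k pdC c ix (fun q => eta a q k 0) p)
  (\col_k pdC c iy (fun q => eta a q k 0) p)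
  (fun k l => conn_form_anti ix k l cp ap) (fun k l => conn_form_anti iy k l cp ap).
move=> E; rewrite -sumrB; apply: etrans (etrans _ E) _.
  apply: eq_bigr => k _; rewrite -(coframe_curl k cp ap) mulrBl opprD addrACA.
  by rewrite addrA.
(* The first sum is the twisted Dirac pairing with its two terms exchanged, hence the minus sign;
   the second already matches. *)
congr (_ + _); rewrite -sumrN; apply: eq_bigr => k _; exact: (esym (opprB _ _)).
Qed.

End SpinFrames.

(** * The quadratic term and the tangency constraints *)

(** Here [f], [fx], [fy] stand for the map and its derivatives, [Ax] and [Ay] for the real pairings
    of one spinor with the Clifford product of another. The leftover term outside the sum is there
    to cancel the first-derivative products in the curl of the map part. *)
Lemma current_product (R : realFieldType) (n : nat) (i m : 'I_n)
    (f fx fy : 'I_n -> R) (Ax Ay : 'I_n -> 'I_n -> R) :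
  \sum_j f j ^+ 2 = 1 -> \sum_j f j * fx j = 0 -> \sum_j f j * fy j = 0 ->
  (forall k, \sum_j Ax k j * f j = 0) -> (forall k, \sum_j f j * Ax j k = 0) ->
  (forall k, \sum_j Ay k j * f j = 0) -> (forall k, \sum_j f j * Ay j k = 0) ->
  \sum_j ((- Ax i j + (fx i * f j - f i * fx j))
            * (- Ay j m + (fy j * f m - f j * fy m))
          - (- Ay i j + (fy i * f j - f i * fy j))
            * (- Ax j m + (fx j * f m - f j * fx m)))
  = \sum_j (Ax i j * Ay j m - Ay i j * Ax j m
           - Ax i j * fy j * f m + Ay j m * f i * fx j
           + Ay i j * fx j * f m - Ax j m * f i * fy j)
    + (fy i * fx m - fx i * fy m).
Proof.
move=> f1 fx0 fy0 Ax1 Ax2 Ay1 Ay2.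
have lin (k : R) (F : 'I_n -> R) (r : R) : \sum_j F j = r -> \sum_j k * F j = k * r.
  by move=> <-; rewrite mulr_sumr.
(* The remaining products are grouped as constants times the sums in the hypotheses; only the
   multiple of the squared length survives. *)
transitivity (\sum_j (Ax i j * Ay j m - Ay i j * Ax j m
           - Ax i j * fy j * f m + Ay j m * f i * fx j
           + Ay i j * fx j * f m - Ax j m * f i * fy j)
  + (\sum_j (fy i * fx m - fx i * fy m) * f j ^+ 2
    + \sum_j (f i * fy m - fy i * f m) * (f j * fx j)
    + \sum_j (fx i * f m - f i * fx m) * (f j * fy j)
    + \sum_j fy m * (Ax i j * f j) + \sum_j (- fx m) * (Ay i j * f j)
    + \sum_j (- fx i) * (f j * Ay j m) + \sum_j fy i * (f j * Ax j m))).
  by rewrite -!big_split; apply: eq_bigr => j _ /=; ring.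
rewrite (lin _ _ _ f1) (lin _ _ _ fx0) (lin _ _ _ fy0) (lin _ _ _ (Ax1 _)).
rewrite (lin _ _ _ (Ay1 _)) (lin _ _ _ (Ax2 _)) (lin _ _ _ (Ay2 _)).
by rewrite !mulr0 !addr0 mulr1.
Qed.

Section SphereMaps.
Variables (R : realType) (M : smooth_surface R) (c : chart R M) (hc : atlas c).
Variables (p : M) (cp : cdom c p).

(** Differentiating the unit length condition gives twice this sum. *)
Lemma sphere_map_pd n (phi : 'I_n.+1 -> M -> R) al :
  sphere_map (cdom c) phi -> \sum_j phi j p * pd c al (phi j) p = 0.
Proof.
move=> [sphi phi1]; have ch := atlas_chart hc; have [oc _ _ _ _] := ch.
have dphi j := smooth_is_pd hc cp al (sphi j) cp.
have d2 := is_pd_sum (fun j => is_pdM ch cp (dphi j) (dphi j)).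
have d0 : is_pd c p al (fun q => \sum_j phi j q * phi j q) 0.
  apply: (is_pd_local ch cp oc cp _ (is_pd_cst c p al 1)) => q cq _.
  by rewrite -(phi1 q cq); apply: eq_bigr => j _; rewrite expr2.
have := is_pdE d0; rewrite (is_pdE d2) big_split/=.
under eq_bigr do rewrite mulrC.
by move=> S2; lra.
Qed.

Lemma wedge_is_pd (f g : M -> R) :
  smooth (cdom c) f -> smooth (cdom c) g ->
  forall a b, is_pd c p a (fun q => pd c b f q * g q - f q * pd c b g q)
    (pd c a (pd c b f) p * g p + pd c b f p * pd c a g p
     - (pd c a f p * pd c b g p + f p * pd c a (pd c b g) p)).
Proof.
move=> sf sg a b; have ch := atlas_chart hc.
apply: is_pdB; apply: is_pdM => //.
- exact: smooth_is_pd_pd.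
- exact: (smooth_is_pd hc cp a sg cp).
- exact: (smooth_is_pd hc cp a sf cp).
- exact: smooth_is_pd_pd.
Qed.

End SphereMaps.

Section TangentSpinors.
Variables (R : realType) (M : smooth_surface R) (h : riemannian_metric M).
Variables (s : spin_structure h) (c : chart R M).

(** Pair the tangency relation, read in the frame chosen at [p], with a fixed spinor; the
    coefficients are real and come out of the pairing. *)
Lemma clifford_tangent n (phi : 'I_n.+1 -> M -> R) (psi : 'I_n.+1 -> spinor s)
    (U : set M) (eta : spinor s) al p :
  section_along U phi psi -> U p ->
  \sum_j phi j p * Re_prod (psi j) (clifford c al eta) p = 0.
Proof.
move=> [_ tan] Up; have := tan _ _ Up (spin_at_dom s p).
move=> /(congr1 (fun u => complex.Re (herm u (clifford c al eta (spin_at s p) p)))).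
have herm0 v : herm (0 : 'cV[R[i]]_2) v = 0.
  by rewrite /herm big1// => k _; rewrite mxE mul0r.
rewrite herm_suml raddf_sum herm0 /= => E; rewrite -[RHS]E; apply: eq_bigr => j _.
rewrite /Re_prod /spinor_prod /herm !sum_ix_iy !mxE.
move: (clifford _ _ _ _ _) (psi _ _ _) => v u.
case: (u ix 0) => ? ?; case: (u iy 0) => ? ?.
by case: (v ix 0) => ? ?; case: (v iy 0) => ? ? /=; ring.
Qed.

Lemma Re_prod_clifford_anti (psi eta : spinor s) al q :
  Re_prod psi (clifford c al eta) q = - Re_prod eta (clifford c al psi) q.
Proof. by rewrite -Re_prod_cliffordC /Re_prod Re_hermC. Qed.

End TangentSpinors.

(** * Curl of the full current *)

Theorem lemma3p7 (R : realType) (M : smooth_surface R)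
  (h : riemannian_metric M) (s : spin_structure h)
  (c : chart R M) (hc : atlas c) (hconn : connected (cdom c))
  (n : nat) (phi : 'I_n.+1 -> M -> R) (psi : 'I_n.+1 -> spinor s)
  (hphi : sphere_map (cdom c) phi)
  (hpsi : section_along (cdom c) phi psi)
  (i m : 'I_n.+1) (p : M) (hp : cdom c p) :
  let J := current c phi psi in
  pd c ix (J iy i m) p - pd c iy (J ix i m) p
    - 2 * \sum_(j < n.+1) (J ix i j p * J iy j m p - J iy i j p * J ix j m p)
  = - Re_prod (twisted_D c (psi i)) (psi m) p
    + Re_prod (psi i) (twisted_D c (psi m)) p
    - 2 * \sum_(j < n.+1)
        (Re_prod (psi i) (clifford c ix (psi j)) p
           * Re_prod (psi j) (clifford c iy (psi m)) p
         - Re_prod (psi i) (clifford c iy (psi j)) p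
           * Re_prod (psi j) (clifford c ix (psi m)) p
         - Re_prod (psi i) (clifford c ix (psi j)) p
           * pd c iy (phi j) p * phi m p
         + Re_prod (psi j) (clifford c iy (psi m)) p
           * phi i p * pd c ix (phi j) p
         + Re_prod (psi i) (clifford c iy (psi j)) p
           * pd c ix (phi j) p * phi m p
         - Re_prod (psi j) (clifford c ix (psi m)) p
           * phi i p * pd c iy (phi j) p).
Proof.
move=> J; have [sphi phi1] := hphi; have [spsi _] := hpsi.
have [oc _ _ _ _] := atlas_chart hc.
have dR al be : is_pd c p be (Re_prod (clifford c al (psi i)) (psi m))
    (pd c be (Re_prod (clifford c al (psi i)) (psi m)) p).
  have d := Re_prod_clifford_is_pd hc al be oc (spsi i) (spsi m) hp hp.
  by rewrite (is_pdE d).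
have dJ al be : pd c be (J al i m) p = _ :=
  is_pdE (is_pdD (dR al be) (wedge_is_pd hc hp (sphi i) (sphi m) be al)).
have curl := Re_prod_clifford_curl hc (spsi i) (spsi m) hp.
(* Tangency in the second slot follows from the first by antisymmetry of the real Clifford
   pairing. *)
have tl al k : \sum_j Re_prod (psi k) (clifford c al (psi j)) p * phi j p = 0.
  transitivity (- \sum_j phi j p * Re_prod (psi j) (clifford c al (psi k)) p).
    rewrite -sumrN; apply: eq_bigr => j _.
    by rewrite Re_prod_clifford_anti mulNr mulrC.
  by rewrite (clifford_tangent c (psi k) al hpsi hp) oppr0.
have prod := @current_product R n.+1 i m (phi ^~ p) (fun j => pd c ix (phi j) p)
  (fun j => pd c iy (phi j) p)
  (fun j k => Re_prod (psi j) (clifford c ix (psi k)) p)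
  (fun j k => Re_prod (psi j) (clifford c iy (psi k)) p) (phi1 p hp)
  (sphere_map_pd hc hp ix hphi) (sphere_map_pd hc hp iy hphi)
  (tl ix) (fun k => clifford_tangent c (psi k) ix hpsi hp)
  (tl iy) (fun k => clifford_tangent c (psi k) iy hpsi hp).
(* [curl] is used backwards: the twisted Dirac terms on the right become the curl of the spinor part
   of the current. *)
rewrite !dJ -curl /J /current.
under eq_bigr do rewrite !Re_prod_cliffordC.
(* With the mixed second derivatives of [phi] identified, they cancel, and the leftover of [prod]
   removes the first-derivative products. *)
rewrite prod (pd_comm hc hp iy ix (sphi i)) (pd_comm hc hp iy ix (sphi m)).
move: (\sum_j _) (pd c ix (Re_prod _ _) p) (pd c iy (Re_prod _ _) p) => S X Y.
move: (pd c ix (pd c iy _) p) (pd c ix (pd c iy _) p) => d e.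
by ring.
Qed.
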